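(* Let $r \ge 2$ and let $\mathcal{H}_1=(V_1,\mathcal{E}_1),\ldots,\mathcal{H}_r=(V_r,\mathcal{E}_r)$ be 3-uniform hypergraphs, and let $G_i=(V_i,E_i)=EI(\mathcal{H}_i)$ for $i=1,\ldots,r$ (each $EI(\mathcal{H}_i)$ being a graph, since $\mathcal{H}_i$ is 3-uniform). Suppose that the graph $G=(V,E)=G_1\cup\cdots\cup G_r=(V_1\cup\cdots\cup V_r,\,E_1\cup\cdots\cup E_r)$ is the clique-fusion $G_1\oplus\cdots\oplus G_r$. Then the hypergraph $\mathcal{H}=\mathcal{H}_1\cup\cdots\cup\mathcal{H}_r=(V_1\cup\cdots\cup V_r,\ \mathcal{E}_1\cup\cdots\cup\mathcal{E}_r)$ is 3-uniform and $G=EI(\mathcal{H})$.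
   Context: All graphs and hypergraphs are finite, may have isolated vertices, and have no loops or multiple edges. A hypergraph $\mathcal{H}=(V,\mathcal{E})$ is $k$-uniform if every hyperedge has exactly $k$ vertices. The edge intersection hypergraph of $\mathcal{H}=(V,\mathcal{E})$ is $EI(\mathcal{H})=(V,\mathcal{E}^{EI})$ with $\mathcal{E}^{EI}=\{e_1\cap e_2 : e_1,e_2\in\mathcal{E},\ e_1\neq e_2,\ |e_1\cap e_2|\ge 2\}$; it has the same vertex set as $\mathcal{H}$, and when it is 2-uniform it is regarded as a simple graph; ''$G=EI(\mathcal{H})$'' means equality of vertex sets and of edge sets. Clique-fusion: given graphs $G_1=(V_1,E_1),\ldots,G_r=(V_r,E_r)$ with $r\ge 2$, let $V'=\{v : v\in V_i\cap V_j \text{ for some } i\neq j\}$ and assume $V'=\{v_1,\ldots,v_k\}$ with $k\ge 1$. If every two distinct vertices of $V'$ are adjacent in the union $G_1\cup\cdots\cup G_r$ (i.e. $V'$ induces a $k$-clique in the union), then the union $G_1\cup\cdots\cup G_r$ is called the clique-fusion (or $k$-fusion) of $G_1,\ldots,G_r$, written $G_1\oplus\cdots\oplus G_r$. *)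

(* Defs.v *)
From HB Require Import structures.
From mathcomp Require Import all_boot.

Set Implicit Arguments.
Unset Strict Implicit.
Unset Printing Implicit Defensive.

(* The vertices live in an ambient finite type [T]; the vertex set is a        *)
(* component of the hypergraph, so that isolated vertices count and different  *)
(* hypergraphs over [T] may have different, overlapping vertex sets.           *)
Definition wf_hypergraph (T : finType) (V : {set T}) (E : {set {set T}}) : bool :=
  [forall e in E, (e \subset V) && (2 <= #|e|)].

Record hypergraph (T : finType) := Hypergraph {
  verts : {set T};
  edges : {set {set T}};
  hypergraph_wf : wf_hypergraph verts edges }.

Lemma hypergraph_ext (T : finType) (H K : hypergraph T) :
  verts H = verts K -> edges H = edges K -> H = K.
Proof.
case: H K => [V E p] [V' E' p'] /= eV eE.
by case: _ / eV p'; case: _ / eE => p'; rewrite (bool_irrelevance p p').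
Qed.

Definition uniform (T : finType) (k : nat) (H : hypergraph T) : bool :=
  [forall e in edges H, #|e| == k].

Definition EI_edges (T : finType) (H : hypergraph T) : {set {set T}} :=
  [set e1 :&: e2 | e1 in edges H, e2 in edges H & (e1 != e2) && (2 <= #|e1 :&: e2|)].

Lemma EI_wf (T : finType) (H : hypergraph T) : wf_hypergraph (verts H) (EI_edges H).
Proof.
apply/forall_inP => e /imset2P[e1 e2 e1E]; rewrite inE.
case/and3P => _ _ ge2 ->; rewrite ge2 andbT.
have /andP[sub _] := forall_inP (hypergraph_wf H) _ e1E.
exact: subset_trans (subsetIl _ _) sub.
Qed.

Definition EI (T : finType) (H : hypergraph T) : hypergraph T :=
  Hypergraph (EI_wf H).

Section Union.
Variables (T : finType) (r : nat).

Lemma hunion_wf (H : 'I_r -> hypergraph T) :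
  wf_hypergraph (\bigcup_i verts (H i)) (\bigcup_i edges (H i)).
Proof.
apply/forall_inP => e /bigcupP[i _ eE].
have /andP[sub ->] := forall_inP (hypergraph_wf (H i)) _ eE.
by rewrite andbT (subset_trans sub) // (bigcup_sup i).
Qed.

Definition hunion (H : 'I_r -> hypergraph T) : hypergraph T :=
  Hypergraph (hunion_wf H).

End Union.

(* A simple graph is a 2-uniform hypergraph; two graphs with the same vertex   *)
(* and edge sets are equal, since the remaining fields are boolean proofs.     *)
Record sgraph (T : finType) := SGraph {
  sgraph_hypergraph :> hypergraph T;
  sgraph_uniform : uniform 2 sgraph_hypergraph }.

Definition adjacent (T : finType) (G : sgraph T) (x y : T) : bool :=
  (x != y) && ([set x; y] \in edges G).

Lemma EI_uniform (T : finType) (H : hypergraph T) :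
  uniform 3 H -> uniform 2 (EI H).
Proof.
move=> /forall_inP H3; apply/forall_inP => e /imset2P[e1 e2 e1E]; rewrite inE.
case/and3P => e2E ne ge2 ->; rewrite eqn_leq ge2 andbT leqNgt.
apply: contraNN ne => gt2.
have eqI f : f \in edges H -> e1 :&: e2 \subset f -> e1 :&: e2 = f.
  by move=> eE sub; apply/eqP; rewrite eqEcard sub (eqP (H3 f eE)).
by rewrite -{1}(eqI e1 e1E (subsetIl _ _)) (eqI e2 e2E (subsetIr _ _)).
Qed.

Definition EI_graph (T : finType) (H : hypergraph T) (H3 : uniform 3 H) : sgraph T :=
  SGraph (EI_uniform H3).

Section CliqueFusion.
Variables (T : finType) (r : nat).
Implicit Types (Gs : 'I_r -> sgraph T) (G : sgraph T).

Lemma gunion_uniform Gs : uniform 2 (hunion Gs).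
Proof.
apply/forall_inP => e /bigcupP[i _ eE].
exact: forall_inP (sgraph_uniform (Gs i)) _ eE.
Qed.

Definition gunion Gs : sgraph T := SGraph (gunion_uniform Gs).

Definition shared_verts Gs : {set T} :=
  [set v | [exists i, exists j, (i != j) && (v \in verts (Gs i) :&: verts (Gs j))]].

Definition is_clique_fusion Gs G : Prop :=
  [/\ 2 <= r,
      shared_verts Gs != set0,
      {in shared_verts Gs &, forall x y, x != y -> adjacent (gunion Gs) x y}
    & G = gunion Gs].

End CliqueFusion.

(* Main.v *)
Require Import Defs.
From mathcomp Require Import all_boot.

(** Two distinct hyperedges coming from different hypergraphs and meeting in at
    least two vertices meet in exactly two, both shared; by the clique condition
    these are joined by an edge that is already in the union. *)

Lemma uniform_hunion (T : finType) (r k : nat) (Hs : 'I_r -> hypergraph T) :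
  (forall i, uniform k (Hs i)) -> uniform k (hunion Hs).
Proof.
move=> Hk; apply/forall_inP => e /bigcupP[i _ eE].
exact: (forall_inP (Hk i)).
Qed.

Lemma edge_sub_verts (T : finType) (H : hypergraph T) (e : {set T}) :
  e \in edges H -> e \subset verts H.
Proof. by move=> /(forall_inP (hypergraph_wf H)) /andP[]. Qed.

(** This gives one inclusion of the theorem: distinctness and intersection size of a pair of
    hyperedges do not depend on the ambient hypergraph. *)
Lemma EI_edges_hunion (T : finType) (r : nat) (Hs : 'I_r -> hypergraph T)
    (i : 'I_r) :
  EI_edges (Hs i) \subset EI_edges (hunion Hs).
Proof.
apply/subsetP => e /imset2P[e1 e2 e1E]; rewrite inE => /andP[e2E ne2] ->.
apply: imset2_f; first by apply/bigcupP; exists i.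
by rewrite inE ne2 andbT; apply/bigcupP; exists i.
Qed.

Theorem theorem3 (T : finType) (r : nat) (Hs : 'I_r -> hypergraph T)
    (r_ge2 : 2 <= r) (Hs3 : forall i : 'I_r, uniform 3 (Hs i)) :
  let Gs := fun i : 'I_r => EI_graph (Hs3 i) in
  let G := gunion Gs in
  is_clique_fusion Gs G ->
  uniform 3 (hunion Hs) /\ (G : hypergraph T) = EI (hunion Hs).
Proof.
move=> Gs G [_ _ clique _].
have H3 := uniform_hunion _ _ _ _ Hs3; split=> //.
(* [EI] keeps the vertex set, so only edge sets remain to be compared. *)
apply: hypergraph_ext => //; apply/eqP; rewrite eqEsubset; apply/andP; split.
  by apply/bigcupsP => i _; apply: EI_edges_hunion.
apply/subsetP => e eEI; have e2 := forall_inP (EI_uniform H3) e eEI.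
case/imset2P: eEI e2 => e1 e2 /bigcupP[i _ e1E].
rewrite inE => /andP[/bigcupP[j _ e2E] ne2] -> /cards2P[x [y [neq_xy e12]]].
have [eq_ij | neq_ij] := eqVneq i j.
  apply/bigcupP; exists i => //; apply: imset2_f => //.
  by rewrite inE ne2 andbT eq_ij.
(* [Gs i] and [Gs j] have all vertices of [Hs i] and [Hs j], hence those of [e1] and [e2]. *)
have shared v : v \in e1 :&: e2 -> v \in shared_verts Gs.
  rewrite inE => /andP[ve1 ve2]; rewrite inE.
  apply/existsP; exists i; apply/existsP; exists j; rewrite neq_ij inE.
  by rewrite (subsetP (edge_sub_verts _ _ _ e1E)) ?(subsetP (edge_sub_verts _ _ _ e2E)).
(* The edge joining [x] and [y] may come from any member of the family, not only from [Gs i] or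
   [Gs j]. *)
have /andP[_] : adjacent G x y.
  by apply: clique => //; apply: shared; rewrite e12 !inE eqxx ?orbT.
by rewrite -e12.
Qed.
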